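(* Let $s_0\in S$ be the initial state and consider the problem of finding a stationary policy $\pi\in\Pi$ such that $$ \mathbf{E}\left(\sum_{k=0}^\infty\gamma^kr^j(s_k,\pi(s_k))\right)\ge0\quad\text{for } j=1,\dots,J. \qquad (\ast) $$ Suppose that $(\ast)$ is feasible and that the absolute values of the reward functions $r^1,\dots,r^J$ are bounded by some constant $c$ known to the agent. Let $\pi^\star$ be an optimal stationary policy in the zero-sum game $$ v(s_0)=\max_{\pi\in\Pi}\min_{j\in[J]}\mathbf{E}\left(\sum_{k=0}^\infty\gamma^kr^j(s_k,\pi(s_k))\right). $$ Then $\pi^\star$ is a feasible solution to $(\ast)$ if and only if $v(s_0)\ge0$.
   Context: $(S,A,P)$ is a Markov decision process with finite state set $S$, finite action set $A$, and transition function $P:S\times A\times S\to[0,1]$, $P(s,a,s_+)=\mathbf{Pr}(s_+\mid s,a)$, $\sum_{s_+\in S}P(s,a,s_+)=1$. $r^j:S\times A\to\mathbb{R}$, $j=1,\dots,J$, are reward functions, $\gamma\in(0,1)$ is a discount factor, and $[J]=\{1,\dots,J\}$. $\Pi$ is the set of (stationary, possibly randomized) policies mapping each state $s$ to a probability distribution over $A$; $\pi(s)=a$ with probability $\mathbf{Pr}(a\mid s)$. The expectation is over the randomness of the policy and of the transitions, starting from $s_0$. An optimal policy in the game is one attaining the maximum over $\Pi$ of the minimum over $j$. *)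

(* Defs.v *)
From HB Require Import structures.
From mathcomp Require Import all_boot all_order all_algebra.
From mathcomp Require Import all_classical all_reals all_analysis.
From mathcomp Require Import lra.

Set Implicit Arguments.
Unset Strict Implicit.
Unset Printing Implicit Defensive.

Import Order.TTheory GRing.Theory Num.Theory.
Import numFieldNormedType.Exports.

Local Open Scope classical_set_scope.
Local Open Scope ring_scope.

Record fdist (R : realType) (T : finType) := Fdist {
  fdist_fun :> T -> R;
  fdist_ge0 : forall x, 0 <= fdist_fun x;
  fdist_sum1 : \sum_x fdist_fun x = 1
}.

Lemma fdist_inhabited (R : realType) (T : finType) (p : fdist R T) :
  exists x : T, true.
Proof.
have [x _|T0] := pickP T; first by exists x.
have := fdist_sum1 p; rewrite big_pred0 // => /eqP.
by rewrite eq_sym oner_eq0.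
Qed.

(* A consistent family q of word weights with total mass 1 is realised on the
   unit interval: words index nested half-open intervals of length q w. *)
Section interval_coding.
Context (R : realType) (T : finType) (t0 : T).
Implicit Types (q : seq T -> R) (a u : R) (w : seq T).

Definition consistent q :=
  (forall w, 0 <= q w) /\ (forall w, \sum_x q (rcons w x) = q w).

Let cum (g : T -> R) k := \sum_(0 <= i < k) g (nth t0 (enum T) i).
Let idx (x : T) := index x (enum T).
Let off q (x : T) := cum (fun y => q [:: y]) (idx x).
Let shift q (x : T) : seq T -> R := fun w => q (x :: w).
Let incell q a u x := (a + off q x <= u) && (u < a + off q x + q [:: x]).
Let pickcell q a u := odflt t0 [pick x | incell q a u x].

Fixpoint code_word n q a u : T :=
  let x := pickcell q a u in
  if n is n'.+1 then code_word n' (shift q x) (a + off q x) u else x.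

Fixpoint left_end q w : R :=
  if w is x :: w' then off q x + left_end (shift q x) w' else 0.

Lemma consistent_shift q x : consistent q -> consistent (shift q x).
Proof. by move=> [q0 qs]; split=> w; [exact: q0|exact: (qs (x :: w))]. Qed.

Let cum_le g k l : (forall x, 0 <= g x) -> (k <= l)%N -> cum g k <= cum g l.
Proof.
move=> g0 kl; rewrite /cum [leRHS](big_cat_nat (n := k)) //= lerDl.
by apply: sumr_ge0 => i _; exact: g0.
Qed.

Let cum_total g : cum g #|T| = \sum_x g x.
Proof.
by rewrite /cum cardE -[RHS]big_enum /= (big_nth t0).
Qed.

Let cum_idxS g x : cum g (idx x).+1 = cum g (idx x) + g x.
Proof. by rewrite /cum big_nat_recr //= nth_index // mem_enum. Qed.

Let incellP q a u x : incell q a u x =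
  (a + cum (fun y => q [:: y]) (idx x) <= u) &&
  (u < a + cum (fun y => q [:: y]) (idx x).+1).
Proof. by rewrite /incell /off cum_idxS addrA. Qed.

Let incell_uniq q a u x y : consistent q ->
  incell q a u x -> incell q a u y -> x = y.
Proof.
move=> [q0 _]; rewrite !incellP => /andP[x1 x2] /andP[y1 y2].
have g0 z : 0 <= q [:: z] by [].
have idxeq : idx x = idx y.
  apply/eqP; rewrite eqn_leq; apply/andP; split; rewrite leqNgt; apply/negP.
    by move=> yx; have := cum_le g0 yx; lra.
  by move=> xy; have := cum_le g0 xy; lra.
have ex z : nth t0 (enum T) (idx z) = z by rewrite nth_index ?mem_enum.
by rewrite -(ex x) idxeq ex.
Qed.

Let incell_ex q a u : consistent q -> a <= u -> u < a + q [::] ->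
  exists x, incell q a u x.
Proof.
move=> [q0 qs] au uq; set g := fun y => q [:: y].
have tot : cum g #|T| = q [::] by rewrite cum_total -[RHS]qs.
have exk : exists k, u < a + cum g k by exists #|T|; rewrite tot.
case: (ex_minnP exk) => -[|k] uk kmin.
  by move: uk; rewrite /cum big_nil addr0 ltNge au.
have kT : (k < #|T|)%N by apply: kmin; rewrite tot.
exists (nth t0 (enum T) k); rewrite incellP.
have -> : idx (nth t0 (enum T) k) = k.
  by rewrite /idx index_uniq ?enum_uniq // -cardE.
rewrite uk andbT leNgt; apply/negP => /kmin; by rewrite ltnn.
Qed.

Let pickcellP q a u x : consistent q -> a <= u -> u < a + q [::] ->
  (pickcell q a u == x) = incell q a u x.
Proof.
move=> cq au uq; rewrite /pickcell; case: pickP => [y iy|no] /=.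
  apply/eqP/idP => [<-//|ix]; exact: incell_uniq iy ix.
by have [y] := incell_ex cq au uq; rewrite no.
Qed.

Lemma left_end_bounds q w : consistent q ->
  0 <= left_end q w /\ left_end q w + q w <= q [::].
Proof.
elim: w q => [|x w ih] q cq /=; first by rewrite add0r.
have [l0 l1] := ih _ (consistent_shift x cq).
have [q0 qs] := cq.
have g0 z : 0 <= q [:: z] by [].
have o0 : 0 <= off q x by apply: sumr_ge0 => i _; exact: q0.
split; first exact: addr_ge0.
have := @cum_le (fun y => q [:: y]) (idx x).+1 #|T| g0 _.
rewrite cum_total cum_idxS -/(off q x) (qs [::]) => h.
have {}h := h _; rewrite cardE index_mem mem_enum in h; have {h} h := h isT.
move: l1; rewrite /shift /= => l1; lra.
Qed.

Lemma code_wordP q a u w : consistent q -> a <= u -> u < a + q [::] ->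
  (mkseq (fun n => code_word n q a u) (size w) == w) =
  (a + left_end q w <= u < a + left_end q w + q w).
Proof.
elim: w q a => [|x w ih] q a cq au uq /=; first by rewrite addr0 au uq.
rewrite /mkseq /= -[in iota _ _]addn1 addnC iotaDl -map_comp /=.
rewrite eqseq_cons (pickcellP x cq au uq).
have [l0 l1] := left_end_bounds w (consistent_shift x cq).
have [ix|nix] /= := boolP (incell q a u x).
  have /eqP px : pickcell q a u == x by rewrite pickcellP.
  move/andP: ix => [ix1 ix2].
  rewrite addrA -(ih _ _ (consistent_shift x cq) ix1 ix2) /mkseq.
  by congr (_ == _); apply: eq_map => n /=; rewrite px.
apply/esym/negbTE; apply: contra nix => /andP[h1 h2]; apply/andP.
by move: l1; rewrite /shift => l1; split; lra.
Qed.

Lemma interval_coding q : consistent q -> q [::] = 1 ->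
  exists f : R -> nat -> T, forall w,
    measurable (f @^-1` [set h | mkseq h (size w) = w]) /\
    lebesgue_measure (f @^-1` [set h | mkseq h (size w) = w] `&` `[0%R, 1%R[)
      = (q w)%:E.
Proof.
move=> cq q1.
pose f (u : R) : nat -> T := if (0 <= u) && (u < 1)
  then (fun n => code_word n q 0 u) else (fun=> t0).
exists f => w; set C := [set h | _].
have fI : f @^-1` C `&` `[0%R, 1%R[ =
          [set` `[left_end q w, left_end q w + q w[].
  have [l0 l1] := left_end_bounds w cq.
  apply/seteqP; split => u /=; rewrite !in_itv /=.
    move=> [+ u01]; rewrite /C /= /f u01; case/andP: u01 => u0 u1 /eqP.
    by rewrite code_wordP ?add0r // q1.
  move=> lu; have u01 : 0 <= u < 1 by rewrite q1 in l1; lra.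
  split => //; rewrite /C /f /= u01; apply/eqP.
  case/andP: u01 => u0 u1.
  by rewrite code_wordP ?add0r // q1.
split; last first.
  rewrite fI lebesgue_measure_itv /= lte_fin ltrDl.
  have [q0 _] := cq; case: ifPn => [_|]; first by rewrite -EFinB addrAC subrr add0r.
  by rewrite -leNgt => h; congr EFin; apply/eqP; rewrite eq_le q0 h.
rewrite -(setUIDK (f @^-1` C) (`[0%R, 1%R[%classic)).
rewrite fI; apply: measurableU; first exact: measurable_itv.
have [tC|tC] := pselect (C (fun=> t0)).
  rewrite (_ : _ `\` _ = ~` `[0%R, 1%R[); first exact: measurableC.
  apply/seteqP; split => u /=; first by case.
  by move=> nu; split => //; move: nu; rewrite in_itv /= /f => /negP/negbTE ->.
rewrite (_ : _ `\` _ = set0); first exact: measurable0.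
apply/seteqP; split => u //= -[+ nu]; move: nu.
by rewrite in_itv /= /f => /negP/negbTE ->.
Qed.

End interval_coding.

Section trajectories.
Context (R : realType) (S A : finType).

Definition policy := S -> fdist R A.

(* The indices s0 and pi only serve to exhibit a point of the space, as
   required by measurableType. *)
Definition trajectory (s0 : S) (pi : policy) : Type := nat -> S * A.

HB.instance Definition _ s0 pi := gen_eqMixin (trajectory s0 pi).
HB.instance Definition _ s0 pi := gen_choiceMixin (trajectory s0 pi).
HB.instance Definition _ s0 pi := isPointed.Build (trajectory s0 pi)
  (fun=> (s0, xchoose (fdist_inhabited (pi s0)))).

Variables (P : S -> A -> fdist R S) (s0 : S) (pi : policy).

Definition cylinder (w : seq (S * A)) : set (trajectory s0 pi) :=
  [set h | mkseq h (size w) = w].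

Definition cylinders : set (set (trajectory s0 pi)) := range cylinder.

Definition trajectory_space := g_sigma_algebraType cylinders.

(* With [:: (x_0, b_0); ...; (x_n, b_n)], mu the law of the state at time 0:
   mu(x_0) pi(b_0 | x_0) P(x_1 | x_0, b_0) pi(b_1 | x_1) ... pi(b_n | x_n). *)
Fixpoint path_prob (mu : S -> R) (w : seq (S * A)) : R :=
  if w is (x, b) :: w' then mu x * pi x b * path_prob (P x b) w' else 1.

Definition start_at : S -> R := fun x => (x == s0)%:R.

Definition is_trajectory_law (Q : probability trajectory_space R) :=
  forall w, Q (cylinder w) = (path_prob start_at w)%:E.

Let path_prob_ge0 mu w : (forall x, 0 <= mu x) -> 0 <= path_prob mu w.
Proof.
elim: w mu => [|[x b] w ih] mu mu0 //=.
by rewrite !mulr_ge0 // ?fdist_ge0 // ih // => y; exact: fdist_ge0.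
Qed.

Let path_prob_rcons mu w : \sum_x mu x = 1 ->
  \sum_x path_prob mu (rcons w x) = path_prob mu w.
Proof.
elim: w mu => [|[x b] w ih] mu mu1 /=.
  rewrite (eq_bigr (fun p => mu p.1 * pi p.1 p.2 * 1)); last by case.
  rewrite -(pair_bigA _ (fun x b => mu x * pi x b * 1)) /=.
  rewrite -[RHS]mu1; apply: eq_bigr => x _.
  under eq_bigr do rewrite mulr1.
  by rewrite -mulr_sumr fdist_sum1 mulr1.
by rewrite -mulr_sumr ih // fdist_sum1.
Qed.

Let start_at_sum1 : \sum_x start_at x = 1.
Proof.
rewrite (bigD1 s0) //= /start_at eqxx big1 ?addr0 // => x /negbTE ->.
by [].
Qed.

Lemma trajectory_law_exists : exists Q, is_trajectory_law Q.
Proof.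
have cq : consistent (path_prob start_at).
  split=> w; last exact: path_prob_rcons.
  by apply: path_prob_ge0 => x; rewrite /start_at ler0n.
have [f Hf] :=
  interval_coding (s0, xchoose (fdist_inhabited (pi s0))) cq erefl.
pose F : measurableTypeR R -> trajectory_space := f.
have mF : measurable_fun setT F.
  have e : @measurable _ trajectory_space = <<s cylinders >> by [].
  refine (@measurability _ _ (measurableTypeR R) trajectory_space setT F cylinders e _).
  move=> _ [_ [w _ <-] <-]; rewrite setTI.
  by have [] := Hf w.
have m01 : measurable (`[0%R, 1%R[%classic : set (measurableTypeR R)).
  exact: measurable_itv.
pose FF : {mfun measurableTypeR R >-> trajectory_space} :=
  HB.pack F (isMeasurableFun.Build _ _ _ _ F mF).
pose U0 := mrestr lebesgue_measure m01.
have U01 : U0 setT = 1%E.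
  by rewrite /U0 /mrestr setTI lebesgue_measure_itv /= lte_fin ltr01 sube0.
pose U : probability (measurableTypeR R) R :=
  HB.pack U0 (Measure_isProbability.Build _ _ _ U0 U01).
exists (distribution U FF) => w.
by have [_ <-] := Hf w.
Qed.

Lemma trajectory_law_unique (Q Q' : probability trajectory_space R) :
  is_trajectory_law Q -> is_trajectory_law Q' ->
  forall E, measurable E -> Q E = Q' E.
Proof.
move=> hQ hQ' E mE.
pose G := cylinders `|` [set set0].
apply: (@measure_unique _ R trajectory_space G (fun=> setT) _ _ _ _ Q Q') => //.
- rewrite /measurable /= /G; apply/seteqP; split.
    by apply: sub_sigma_algebra2; exact: subsetUl.
  apply: smallest_sub; first exact: smallest_sigma_algebra.
  move=> C [CC|->]; last exact: sigma_algebra0.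
  exact: sub_sigma_algebra.
- suff key (w w' : seq (S * A)) : (size w <= size w')%N ->
      G (cylinder w `&` cylinder w').
    move=> X Y [[w _ <-]|->]; last by rewrite set0I; right.
    move=> [[w' _ <-]|->]; last by rewrite setI0; right.
    have [|/ltnW] := leqP (size w) (size w'); first exact: key.
    by rewrite setIC; exact: key.
  move=> ww'; have tk h : mkseq h (size w) = take (size w) (mkseq h (size w')).
    by rewrite /mkseq -map_take take_iota (minn_idPl ww').
  have [e|ne] := eqVneq (take (size w) w') w.
    left; exists w' => //; apply/seteqP; split => h /=; last by case.
    rewrite /cylinder /= => hw'; split => //.
    by rewrite tk // hw'.
  right; apply/seteqP; split => h //= -[hw hw']; case/eqP: ne.
  by rewrite -hw' -tk.
- by move=> _; left; exists [::] => //; apply/seteqP; split.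
- by rewrite bigcup_const.
- move=> _ [[w _ <-]|->]; last by rewrite !measure0.
  exact: etrans (hQ w) (esym (hQ' w)).
- by move=> k; exact: (le_lt_trans (probability_le1 Q measurableT) (ltry 1)).
Qed.

(* The law of (s_k, a_k)_k when s_0 is the initial state, a_k ~ pi(s_k) and
   s_{k+1} ~ P(s_k, a_k); on measurable sets it is the only one with these
   cylinder probabilities, by trajectory_law_unique. *)
Definition trajectory_law : probability trajectory_space R :=
  projT1 (cid trajectory_law_exists).

Lemma trajectory_lawP : is_trajectory_law trajectory_law.
Proof. exact: projT2 (cid trajectory_law_exists). Qed.

End trajectories.

Section discounted_game.
Context (R : realType) (S A : finType) (J : nat).
Variables (P : S -> A -> fdist R S) (r : 'I_J -> S -> A -> R).
Variables (gamma : R) (s0 : S).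

Definition discounted_return (j : 'I_J) (h : nat -> S * A) : R :=
  limn (series (fun k => gamma ^+ k * r j (h k).1 (h k).2)).

Definition policy_value (pi : policy R S A) (j : 'I_J) : \bar R :=
  'E_(trajectory_law P s0 pi)[discounted_return j]%E.

Definition satisfies_constraints (pi : policy R S A) :=
  forall j, (0 <= policy_value pi j)%E.

(* +oo is the neutral element of mine: a genuine minimum as soon as 0 < J. *)
Definition worst_value (pi : policy R S A) : \bar R :=
  \big[mine/+oo%E]_(j < J) policy_value pi j.

Definition game_value : \bar R := ereal_sup (range worst_value).

Definition optimal_policy (pi : policy R S A) :=
  forall pi', (worst_value pi' <= worst_value pi)%E.

End discounted_game.

(* Main.v *)
Require Import Defs.
From mathcomp Require Import all_boot all_order all_algebra.
From mathcomp Require Import all_classical all_reals all_analysis.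

Import Order.TTheory GRing.Theory Num.Theory.
Import numFieldNormedType.Exports.

Local Open Scope classical_set_scope.
Local Open Scope ring_scope.

(** Since the minimum of finitely many values is nonnegative exactly when each
    of them is, a policy satisfies the constraints iff its worst value is
    nonnegative ([satisfies_constraintsE]).  An optimal policy attains the
    supremum defining the value of the game ([optimal_policy_game_value]), so
    for it the worst value is the value of the game. *)

Lemma satisfies_constraintsE (R : realType) (S A : finType)
    (P : S -> A -> fdist R S) (J : nat) (r : 'I_J -> S -> A -> R)
    (gamma : R) (s0 : S) (pi : policy R S A) :
  satisfies_constraints P r gamma s0 pi <->
  (0 <= worst_value P r gamma s0 pi)%E.
Proof.
split=> [pi_ge0|/bigmin_geP[_ pi_ge0] j]; last exact: pi_ge0.
by apply/bigmin_geP; split=> [|j _]; [exact: leey|exact: pi_ge0].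
Qed.

Lemma optimal_policy_game_value (R : realType) (S A : finType)
    (P : S -> A -> fdist R S) (J : nat) (r : 'I_J -> S -> A -> R)
    (gamma : R) (s0 : S) (pi : policy R S A) :
  optimal_policy P r gamma s0 pi ->
  game_value P r gamma s0 = worst_value P r gamma s0 pi.
Proof.
move=> pi_opt; apply/eqP; rewrite eq_le; apply/andP; split.
  by apply: ge_ereal_sup => _ [pi' _ <-]; exact: pi_opt.
by apply: ereal_sup_ubound; exists pi.
Qed.

Theorem theorem3 (R : realType) (S A : finType) (P : S -> A -> fdist R S)
    (J : nat) (J_gt0 : (0 < J)%N) (r : 'I_J -> S -> A -> R)
    (gamma : R) (gamma_gt0 : 0 < gamma) (gamma_lt1 : gamma < 1) (s0 : S)
    (feasible : exists pi : policy R S A,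
      satisfies_constraints P r gamma s0 pi)
    (c : R) (r_bounded : forall j s a, `|r j s a| <= c)
    (pistar : policy R S A)
    (pistar_optimal : optimal_policy P r gamma s0 pistar) :
  satisfies_constraints P r gamma s0 pistar <->
  (0%E <= game_value P r gamma s0)%E.
Proof.
rewrite (optimal_policy_game_value _ _ _ _ _ _ _ _ _ pistar_optimal).
exact: satisfies_constraintsE.
Qed.
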